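(* Let $0<t<1$, let $a<b$, and let $s_{[a,b]}$ be a recursively defined partition of unity approximation on $[a,b]$ with overlap parameter $t$, represented by a finite binary tree $T$ with leaves numbered $1,\dots,M$. Then the tree $T$ implicitly defines a partition of unity on $[a,b]$ over its leaves: if $w_k$ ($1\le k\le M$) denotes the product of the weights along the path from the root of $T$ to the $k$-th leaf, then each $w_k$ is nonnegative on $[a,b]$, each $w_k$ has (compact) support within the interval of the $k$-th leaf, and $\sum_{k=1}^M w_k(x)=1$ for all $x\in[a,b]$.
   Context: Reference weights. Let $\psi(x)=\exp\left(1-\frac{1}{1-x^2}\right)$ for $|x|<1$ and $\psi(x)=0$ for $|x|\ge 1$. For $0<t<1$ put $\psi_\ell(x)=\psi\left(\frac{x+1}{1+t}\right)$, $\psi_r(x)=\psi\left(\frac{x-1}{1+t}\right)$, and for $x\in[-1,1]$ $$w_\ell(x)=\frac{\psi_\ell(x)}{\psi_\ell(x)+\psi_r(x)},\qquad w_r(x)=\frac{\psi_r(x)}{\psi_\ell(x)+\psi_r(x)},$$ which have support in $[-1,t]$ and $[-t,1]$ respectively. For an interval $[\alpha,\beta]$, the weights for $[\alpha,\beta]$ are $w_\ell\circ\phi$ and $w_r\circ\phi$, where $\phi(x)=\frac{2x-\alpha-\beta}{\beta-\alpha}$ maps $[\alpha,\beta]$ affinely onto $[-1,1]$. Recursive approximation and its tree. Each node of the finite binary tree $T$ carries an interval; the root carries $[a,b]$. A node with interval $[\alpha,\beta]$ is either a leaf, in which case $s_{[\alpha,\beta]}$ is a single (polynomial) interpolant on $[\alpha,\beta]$,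 or it is split: with $\delta=(1+t)\frac{\beta-\alpha}{2}$, its left child carries $[\alpha,\alpha+\delta]$, its right child carries $[\beta-\delta,\beta]$, and $$s_{[\alpha,\beta]}(x)=w_\ell(\phi(x))\,s_{[\alpha,\alpha+\delta]}(x)+w_r(\phi(x))\,s_{[\beta-\delta,\beta]}(x),$$ with terms understood as $0$ outside the corresponding child's interval. The edge from a split node to its left (right) child carries the left weight $w_\ell\circ\phi$ (right weight $w_r\circ\phi$) for that node's interval. The product of the weights along the path from the root to a leaf is regarded as a function on $[a,b]$, taken to be $0$ at points where some factor is not defined (such points lie outside the leaf's interval); if the root itself is a leaf, the product is the constant $1$. A partition of unity on $[a,b]$ over intervals $\Omega_1,\dots,\Omega_M$ covering $[a,b]$ is a collection of nonnegative real-valued functions $w_1,\dots,w_M$ on $[a,b]$, with $w_k$ having support within $\Omega_k$, whose sum is identically $1$ on $[a,b]$. *)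

(* Defs.v *)
From HB Require Import structures.
From mathcomp Require Import all_boot all_order all_algebra.
From mathcomp Require Import all_classical all_reals all_analysis.

Set Implicit Arguments.
Unset Strict Implicit.
Unset Printing Implicit Defensive.

Import Order.TTheory GRing.Theory Num.Theory.
Import numFieldNormedType.Exports.

Local Open Scope classical_set_scope.
Local Open Scope ring_scope.

Definition psi {R : realType} (x : R) : R :=
  if `|x| < 1 then expR (1 - 1 / (1 - x ^+ 2)) else 0.

Definition psi_left {R : realType} (t x : R) : R := psi ((x + 1) / (1 + t)).
Definition psi_right {R : realType} (t x : R) : R := psi ((x - 1) / (1 + t)).

(* The reference weights are only meaningful for x in [-1, 1]; elsewhere the
   values of these total functions are never used. *)
Definition ref_left {R : realType} (t x : R) : R :=
  psi_left t x / (psi_left t x + psi_right t x).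
Definition ref_right {R : realType} (t x : R) : R :=
  psi_right t x / (psi_left t x + psi_right t x).

Definition to_ref {R : realType} (alpha beta x : R) : R :=
  (2 * x - alpha - beta) / (beta - alpha).

Definition weight_left {R : realType} (t alpha beta x : R) : R :=
  ref_left t (to_ref alpha beta x).
Definition weight_right {R : realType} (t alpha beta x : R) : R :=
  ref_right t (to_ref alpha beta x).

Definition child_length {R : realType} (t alpha beta : R) : R :=
  (1 + t) * ((beta - alpha) / 2).

(* A tree of type [rpu_tree t alpha beta] is one whose root carries the interval
   [alpha, beta]. A leaf stores its polynomial interpolant. *)
Inductive rpu_tree {R : realType} (t alpha beta : R) : Type :=
| Leaf of {poly R}
| Split of rpu_tree t alpha (alpha + child_length t alpha beta)
         & rpu_tree t (beta - child_length t alpha beta) beta.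

Arguments Leaf {R t alpha beta} _.
Arguments Split {R t alpha beta} _ _.

Fixpoint approx {R : realType} {t alpha beta : R} (T : rpu_tree t alpha beta)
    (x : R) : R :=
  match T with
  | Leaf p => p.[x]
  | Split Tl Tr =>
      (if x \in `[alpha, alpha + child_length t alpha beta]
       then weight_left t alpha beta x * approx Tl x else 0)
    + (if x \in `[beta - child_length t alpha beta, beta]
       then weight_right t alpha beta x * approx Tr x else 0)
  end.

Definition represents {R : realType} {t a b : R} (T : rpu_tree t a b)
    (s : R -> R) : Prop :=
  {in `[a, b], s =1 approx T}.

(* A node is addressed by the path leading to it from the root: [false] follows
   the edge to the left child, [true] the edge to the right child. *)
Fixpoint leaf_paths {R : realType} {t alpha beta : R}
    (T : rpu_tree t alpha beta) : seq (seq bool) :=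
  match T with
  | Leaf _ => [:: [::]]
  | Split Tl Tr =>
      [seq false :: q | q <- leaf_paths Tl] ++ [seq true :: q | q <- leaf_paths Tr]
  end.

Fixpoint node_interval {R : realType} {t alpha beta : R}
    (T : rpu_tree t alpha beta) (q : seq bool) : interval R :=
  match T, q with
  | Split Tl _, false :: q' => node_interval Tl q'
  | Split _ Tr, true :: q' => node_interval Tr q'
  | _, _ => `[alpha, beta]
  end.

(* The weights carried by the edges of a path, each paired with the interval on
   which it is defined. *)
Fixpoint path_factors {R : realType} {t alpha beta : R}
    (T : rpu_tree t alpha beta) (q : seq bool) : seq (interval R * (R -> R)) :=
  match T, q with
  | Split Tl _, false :: q' =>
      (`[alpha, beta], weight_left t alpha beta) :: path_factors Tl q'
  | Split _ Tr, true :: q' =>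
      (`[alpha, beta], weight_right t alpha beta) :: path_factors Tr q'
  | _, _ => [::]
  end.

Definition path_weight {R : realType} {t a b : R} (T : rpu_tree t a b)
    (q : seq bool) (x : R) : R :=
  if all (fun f => x \in f.1) (path_factors T q)
  then \prod_(f <- path_factors T q) f.2 x else 0.

(* Only the restriction of f to [a, b] matters; as [a, b] is closed, the closure
   in R is the closure in [a, b]. *)
Definition support_on {R : realType} (a b : R) (f : R -> R) : set R :=
  closure [set x : R | x \in `[a, b] /\ f x != 0].

Definition partition_of_unity {R : realType} (a b : R) (M : nat)
    (Omega : 'I_M -> interval R) (w : 'I_M -> R -> R) : Prop :=
  [/\ [set` `[a, b]] `<=` \bigcup_(k in [set: 'I_M]) [set` Omega k],
      forall k x, x \in `[a, b] -> 0 <= w k x,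
      forall k, support_on a b (w k) `<=` [set` Omega k]
    & forall x, x \in `[a, b] -> \sum_(k < M) w k x = 1].

(* Main.v *)
Require Import Defs.
From HB Require Import structures.
From mathcomp Require Import all_boot all_order all_algebra.
From mathcomp Require Import all_classical all_reals all_analysis.
From mathcomp Require Import lra.

Set Implicit Arguments.
Unset Strict Implicit.
Unset Printing Implicit Defensive.

Import Order.TTheory GRing.Theory Num.Theory.
Import numFieldNormedType.Exports.

Local Open Scope classical_set_scope.
Local Open Scope ring_scope.

(** The whole argument is an induction on the tree, run at a fixed point [x].
    Peeling off the first edge of a path multiplies the path weight by the
    weight of that edge ([path_weight_left], [path_weight_right]). At a split
    node the two edge weights are nonnegative and add up to [1] on the interval
    of the node, because at least one of the two bumps is positive there
    ([ref_weights_sum1]); and each edge weight vanishes at the points of the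
    node that lie outside the child it leads to ([weight_left_neq0],
    [weight_right_neq0]).

    The vanishing propagates along a path: a point of [[a, b]] with nonzero
    path weight stays inside every interval met on the way down, so it lies in
    the interval of the leaf ([path_weight_neq0]), and as that interval is
    closed it contains the closure of such points too. It also makes the sum
    collapse: the leaves below the left child contribute the left weight times
    the sum for the left subtree, where that sum is [1] if [x] lies in the left
    child and is multiplied by [0] otherwise; likewise on the right; so the total
    is the sum of the two edge weights, which is [1] ([sum_path_weight]).

    That the leaves cover [[a, b]] is then a consequence: weights with sum [1]
    cannot all vanish, and a nonvanishing one locates the point in a leaf. *)

Lemma psi_ge0 (R : realType) (x : R) : 0 <= psi x.
Proof. by rewrite /psi; case: ifP => // _; exact: expR_ge0. Qed.

Lemma psi_gt0 (R : realType) (x : R) : (0 < psi x) = (`|x| < 1).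
Proof. by rewrite /psi; case: ifP; rewrite ?expR_gt0 ?ltxx. Qed.

Lemma psi_left_gt0 (R : realType) (t x : R) : 0 < t ->
  (0 < psi_left t x) = (`|x + 1| < 1 + t).
Proof.
move=> t0; have t1 : 0 < 1 + t by rewrite addr_gt0.
by rewrite psi_gt0 normrM normfV (gtr0_norm t1) ltr_pdivrMr // mul1r.
Qed.

Lemma psi_right_gt0 (R : realType) (t x : R) : 0 < t ->
  (0 < psi_right t x) = (`|x - 1| < 1 + t).
Proof.
move=> t0; have t1 : 0 < 1 + t by rewrite addr_gt0.
by rewrite psi_gt0 normrM normfV (gtr0_norm t1) ltr_pdivrMr // mul1r.
Qed.

(** The left bump is positive on []-2 - t, t[] and the right one on []-t, 2 + t[];
    since [t] is positive these two intervals cover [[-1, 1]]. *)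
Lemma psi_sum_gt0 (R : realType) (t x : R) : 0 < t -> -1 <= x <= 1 ->
  0 < psi_left t x + psi_right t x.
Proof.
move=> t0 /andP[x_ge x_le]; have [x0|x0] := lerP x 0.
- by apply: ltr_wpDr; rewrite ?psi_ge0 // psi_left_gt0 // ltr_norml; lra.
- by apply: ltr_wpDl; rewrite ?psi_ge0 // psi_right_gt0 // ltr_norml; lra.
Qed.

Lemma ref_weights_sum1 (R : realType) (t x : R) : 0 < t -> -1 <= x <= 1 ->
  ref_left t x + ref_right t x = 1.
Proof.
by move=> t0 x1; rewrite -mulrDl divff // gt_eqF // psi_sum_gt0.
Qed.

Lemma ref_left_ge0 (R : realType) (t x : R) : 0 <= ref_left t x.
Proof. by rewrite divr_ge0 ?addr_ge0 ?psi_ge0. Qed.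

Lemma ref_right_ge0 (R : realType) (t x : R) : 0 <= ref_right t x.
Proof. by rewrite divr_ge0 ?addr_ge0 ?psi_ge0. Qed.

Lemma ref_left_neq0 (R : realType) (t x : R) : 0 < t ->
  ref_left t x != 0 -> x < t.
Proof.
move=> t0; rewrite mulf_eq0 => /norP[psi_neq0 _].
have : 0 < psi_left t x by rewrite lt_def psi_neq0 psi_ge0.
by rewrite psi_left_gt0 // ltr_norml; lra.
Qed.

Lemma ref_right_neq0 (R : realType) (t x : R) : 0 < t ->
  ref_right t x != 0 -> - t < x.
Proof.
move=> t0; rewrite mulf_eq0 => /norP[psi_neq0 _].
have : 0 < psi_right t x by rewrite lt_def psi_neq0 psi_ge0.
by rewrite psi_right_gt0 // ltr_norml; lra.
Qed.

(** Nondegeneracy of the interval, without which [to_ref] is meaningless, is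
    inherited by both children, as they have length [child_length]. *)
Lemma child_length_gt0 (R : realType) (t alpha beta : R) :
  0 < t -> alpha < beta -> 0 < child_length t alpha beta.
Proof.
by move=> t0 ab; rewrite mulr_gt0 ?addr_gt0 ?divr_gt0 ?subr_gt0.
Qed.

Lemma to_ref_bounds (R : realType) (alpha beta x : R) : alpha < beta ->
  x \in `[alpha, beta] -> -1 <= to_ref alpha beta x <= 1.
Proof.
move=> ab; rewrite in_itv /= => /andP[ax xb].
by rewrite ler_pdivlMr ?ler_pdivrMr ?subr_gt0 //; lra.
Qed.

Lemma weights_sum1 (R : realType) (t alpha beta x : R) : 0 < t ->
  alpha < beta -> x \in `[alpha, beta] ->
  weight_left t alpha beta x + weight_right t alpha beta x = 1.
Proof. by move=> t0 ab xab; rewrite ref_weights_sum1 ?to_ref_bounds. Qed.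

(** The left child is cut exactly where [to_ref] takes the value [t], the right
    end of the support of the left reference weight. *)
Lemma weight_left_neq0 (R : realType) (t alpha beta x : R) : 0 < t ->
  alpha < beta -> x \in `[alpha, beta] -> weight_left t alpha beta x != 0 ->
  x \in `[alpha, alpha + child_length t alpha beta].
Proof.
move=> t0 ab + /(ref_left_neq0 t0).
rewrite ltr_pdivrMr ?subr_gt0 // !in_itv /= /child_length.
by move=> /andP[ax xb] ?; rewrite ax /=; lra.
Qed.

Lemma weight_right_neq0 (R : realType) (t alpha beta x : R) : 0 < t ->
  alpha < beta -> x \in `[alpha, beta] -> weight_right t alpha beta x != 0 ->
  x \in `[beta - child_length t alpha beta, beta].
Proof.
move=> t0 ab + /(ref_right_neq0 t0).
rewrite ltr_pdivlMr ?subr_gt0 // !in_itv /= /child_length.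
by move=> /andP[ax xb] ?; rewrite xb andbT; lra.
Qed.

Lemma path_weight_left (R : realType) (t alpha beta x : R)
    (Tl : rpu_tree t alpha (alpha + child_length t alpha beta))
    (Tr : rpu_tree t (beta - child_length t alpha beta) beta) (q : seq bool) :
  x \in `[alpha, beta] ->
  path_weight (Defs.Split Tl Tr) (false :: q) x =
    weight_left t alpha beta x * path_weight Tl q x.
Proof.
move=> xab; rewrite /path_weight /= xab /=.
by case: ifP => _; rewrite ?mulr0 // big_cons.
Qed.

Lemma path_weight_right (R : realType) (t alpha beta x : R)
    (Tl : rpu_tree t alpha (alpha + child_length t alpha beta))
    (Tr : rpu_tree t (beta - child_length t alpha beta) beta) (q : seq bool) :
  x \in `[alpha, beta] ->
  path_weight (Defs.Split Tl Tr) (true :: q) x =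
    weight_right t alpha beta x * path_weight Tr q x.
Proof.
move=> xab; rewrite /path_weight /= xab /=.
by case: ifP => _; rewrite ?mulr0 // big_cons.
Qed.

Lemma path_factors_ge0 (R : realType) (t alpha beta x : R)
    (T : rpu_tree t alpha beta) (q : seq bool) :
  0 <= \prod_(f <- path_factors T q) f.2 x.
Proof.
elim: T q => [? ? ?|? ? Tl IHl Tr IHr] [|[] q] /=; rewrite ?big_nil //.
- by rewrite big_cons mulr_ge0 ?ref_right_ge0.
- by rewrite big_cons mulr_ge0 ?ref_left_ge0.
Qed.

Lemma path_weight_ge0 (R : realType) (t alpha beta x : R)
    (T : rpu_tree t alpha beta) (q : seq bool) : 0 <= path_weight T q x.
Proof. by rewrite /path_weight; case: ifP => // _; exact: path_factors_ge0. Qed.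

(** A nonzero product has only nonzero factors, so at every node of the path the
    point passes from the interval of the node to that of the next child. *)
Lemma path_weight_neq0 (R : realType) (t alpha beta x : R)
    (T : rpu_tree t alpha beta) (q : seq bool) : 0 < t -> alpha < beta ->
  x \in `[alpha, beta] -> path_weight T q x != 0 -> x \in node_interval T q.
Proof.
move=> t0; elim: T q => [? ? ?|al be Tl IHl Tr IHr] [|[] q] //= ab xab.
- rewrite path_weight_right // mulf_eq0 => /norP[/(weight_right_neq0 t0 ab xab)].
  by move=> /IHr; apply; rewrite ltrBlDr ltrDl child_length_gt0.
- rewrite path_weight_left // mulf_eq0 => /norP[/(weight_left_neq0 t0 ab xab)].
  by move=> /IHl; apply; rewrite ltrDl child_length_gt0.
Qed.

Lemma sum_path_weight (R : realType) (t alpha beta x : R)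
    (T : rpu_tree t alpha beta) : 0 < t -> alpha < beta ->
  x \in `[alpha, beta] -> \sum_(q <- leaf_paths T) path_weight T q x = 1.
Proof.
move=> t0; elim: T => [? ? ?|al be Tl IHl Tr IHr] /= ab xab.
  by rewrite big_seq1 /path_weight big_nil.
have suml : \sum_(q <- leaf_paths Tl) path_weight (Defs.Split Tl Tr) (false :: q) x
    = weight_left t al be x.
  under eq_bigr do rewrite path_weight_left //.
  rewrite -mulr_sumr; have [->|] := eqVneq (weight_left t al be x) 0.
    by rewrite mul0r.
  by move=> /(weight_left_neq0 t0 ab xab) /IHl ->;
    rewrite ?mulr1 // ltrDl child_length_gt0.
have sumr : \sum_(q <- leaf_paths Tr) path_weight (Defs.Split Tl Tr) (true :: q) x
    = weight_right t al be x.
  under eq_bigr do rewrite path_weight_right //.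
  rewrite -mulr_sumr; have [->|] := eqVneq (weight_right t al be x) 0.
    by rewrite mul0r.
  by move=> /(weight_right_neq0 t0 ab xab) /IHr ->;
    rewrite ?mulr1 // ltrBlDr ltrDl child_length_gt0.
by rewrite big_cat !big_map suml sumr /= weights_sum1.
Qed.

Lemma node_interval_closed (R : realType) (t alpha beta : R)
    (T : rpu_tree t alpha beta) (q : seq bool) :
  closed [set` node_interval T q].
Proof.
by elim: T q => [? ? ?|? ? ? IHl ? IHr] [|[] q] /=;
  (exact: IHl || exact: IHr || exact: itv_closed).
Qed.

Lemma support_on_subset (R : realType) (a b : R) (f : R -> R) (A : set R) :
  closed A -> (forall x, x \in `[a, b] -> f x != 0 -> A x) ->
  support_on a b f `<=` A.
Proof.
move=> /closure_id clA fA; rewrite clA; apply: closure_subset => x [xab fx].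
exact: fA.
Qed.

Lemma support_on_compact (R : realType) (a b : R) (f : R -> R) :
  compact (support_on a b f).
Proof.
apply: (subclosed_compact _ (@segment_compact R a b)).
- exact: closed_closure.
- by apply: support_on_subset => //; exact: itv_closed.
Qed.

Theorem theorem5p1 (R : realType) (t a b : R) (t_gt0 : 0 < t) (t_lt1 : t < 1)
    (a_lt_b : a < b) (s : R -> R) (T : rpu_tree t a b) (s_T : represents T s)
    (M : nat) (leaf : M.-tuple (seq bool))
    (leaf_T : perm_eq leaf (leaf_paths T)) :
  let Omega (k : 'I_M) := node_interval T (tnth leaf k) in
  let w (k : 'I_M) := path_weight T (tnth leaf k) in
  partition_of_unity a b Omega w /\
  (forall k : 'I_M, compact (support_on a b (w k))).
Proof.
move=> Omega w.
have supp k x : x \in `[a, b] -> w k x != 0 -> x \in Omega k.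
  exact: path_weight_neq0.
have sum1 x : x \in `[a, b] -> \sum_(k < M) w k x = 1.
  move=> xab; rewrite -(big_tuple _ _ leaf predT (fun q => path_weight T q x)).
  by rewrite (perm_big _ leaf_T) /= sum_path_weight.
split; last by move=> k; exact: support_on_compact.
split=> //.
- move=> x /= xab; apply: contrapT => x_uncovered.
  have /eqP := sum1 x xab; rewrite big1 ?(eq_sym 0) ?oner_eq0 // => k _.
  by apply: contrapT => /eqP /(supp k x xab) xk; apply: x_uncovered; exists k.
- by move=> k x _; exact: path_weight_ge0.
- by move=> k; apply: support_on_subset; [exact: node_interval_closed|exact: supp].
Qed.
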